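(* Let $X$ be a Banach space and let $\sum_{i=0}^\infty a_i$ be an absolutely convergent series in $X$. Then for every $\alpha\in\omega_1\setminus\omega$ and every bijection $f\colon\alpha\to\omega$, the well-ordered series $\Sigma(a_{f(i)})_{i\in\alpha}$ absolutely converges and \[\sum_{i\in\alpha}a_{f(i)}=\sum_{i=0}^\infty a_i.\]
   Context: Ordinals are von Neumann ordinals; $\omega$ is the set of finite ordinals, $\omega_1$ the set of countable ordinals. For a normed space $Y$ and $\beta\in\omega_1\setminus\omega$, a hypersequence is a function $a\colon\beta\to Y$. A function $s\colon\gamma\to Y$ is a partial sum hypersequence of $a$ if (1) $1\le\gamma\le\beta+1$; (2) $s_0=0$; (3) $s_{\alpha+1}=s_\alpha+a_\alpha$ whenever $\alpha+1\in\gamma$; (4) for each limit ordinal $\lambda\in\gamma$, $s_\lambda=\lim_{\alpha\to\lambda}s_\alpha$ (for every $\varepsilon>0$ there is $\alpha_0\in\lambda$ with $\|s_\lambda-s_\alpha\|<\varepsilon$ for all $\alpha_0\le\alpha<\lambda$). There is a largest partial sum hypersequence $\sigma a$ (every other one is a restriction of it). The well-ordered series $\Sigma a$ converges if the domain of $\sigma a$ is $\beta+1$, and then its sum is $\sum_{\alpha\in\beta}a_\alpha:=(\sigma a)_\beta$. The well-ordered series $\Sigma(a_\alpha)_{\alpha\in\beta}$ absolutely converges if $\Sigma(\|a_\alpha\|)_{\alpha\in\beta}$ converges. For $\beta=\omega$ these notions coincide with ordinary series convergence, sum, and absolute convergence. *)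

(* Defs.v *)
From HB Require Import structures.
From mathcomp Require Import all_boot all_order all_algebra.
From mathcomp Require Import all_classical wochoice all_reals all_analysis.

Set Implicit Arguments.
Unset Strict Implicit.
Unset Printing Implicit Defensive.

Import Order.TTheory GRing.Theory Num.Theory.
Import numFieldNormedType.Exports.

Local Open Scope classical_set_scope.
Local Open Scope ring_scope.

(* An ordinal beta is represented by a well-ordered type A of order type beta
   (an orderType whose <=%O satisfies [well_order]); the elements of A are the
   ordinals below beta.  [osucc A] represents beta + 1: [Some x] is the element
   x of beta and [None], put on top, is the ordinal beta itself. *)
Definition osucc (A : Type) : Type := option A.

Section OSucc.
Context {d : Order.disp_t} {A : orderType d}.

HB.instance Definition _ := Choice.on (osucc A).

Definition osucc_le (x y : osucc A) : bool :=
  match x, y with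
  | _, None => true
  | None, Some _ => false
  | Some u, Some v => (u <= v)%O
  end.

Definition osucc_lt (x y : osucc A) : bool :=
  match x, y with
  | None, _ => false
  | Some _, None => true
  | Some u, Some v => (u < v)%O
  end.

Fact osucc_lt_def x y : osucc_lt x y = (y != x) && osucc_le x y.
Proof. by case: x y => [u|] [v|] //=; rewrite lt_def. Qed.

Fact osucc_le_refl : reflexive osucc_le.
Proof. by case=> //= u. Qed.

Fact osucc_le_anti : antisymmetric osucc_le.
Proof. by move=> [u|] [v|] //= /le_anti ->. Qed.

Fact osucc_le_trans : transitive osucc_le.
Proof. by move=> [v|] [u|] [w|] //=; apply: le_trans. Qed.

Fact osucc_le_total : total osucc_le.
Proof. by move=> [u|] [v|] //=; apply: le_total. Qed.

HB.instance Definition _ := Order.isPOrder.Build d (osucc A)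
  osucc_lt_def osucc_le_refl osucc_le_anti osucc_le_trans.
HB.instance Definition _ :=
  Order.POrder_isTotal.Build d (osucc A) osucc_le_total.

End OSucc.

Section OrdinalPositions.
Context {d : Order.disp_t} {T : orderType d}.

Definition ord_zero (x : T) : Prop := forall y, (x <= y)%O.

(* y = x + 1 *)
Definition ord_next (x y : T) : Prop :=
  (x < y)%O /\ forall z, (x < z)%O -> (y <= z)%O.

Definition ord_limit (x : T) : Prop :=
  ~ ord_zero x /\ ~ exists y, ord_next y x.

End OrdinalPositions.

Section Hyperseries.
Context {R : realType} {Y : normedModType R} {d : Order.disp_t} {A : orderType d}.
Implicit Types (a : A -> Y) (D : set (osucc A)) (s : osucc A -> Y).

(* The ordinals gamma with 1 <= gamma <= beta + 1 are the nonempty initial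
   segments D of beta + 1.  A function gamma -> Y is represented by the pair of
   its domain D and a total function s whose values outside D are irrelevant. *)
Definition partial_sum_hyperseq a D s : Prop :=
  [/\ D !=set0 /\ (forall x y, D x -> (y <= x)%O -> D y),
      forall x, ord_zero x -> s x = 0,
      forall (x : A) (y : osucc A),
        ord_next (Some x : osucc A) y -> D y -> s y = s (Some x) + a x
    & forall l, ord_limit l -> D l -> forall e : R, 0 < e ->
        exists2 x0, (x0 < l)%O &
          forall x, (x0 <= x)%O -> (x < l)%O -> `|s l - s x| < e].

Definition largest_partial_sum_hyperseq a (p : set (osucc A) * (osucc A -> Y)) :
    Prop :=
  partial_sum_hyperseq a p.1 p.2 /\
  forall D s, partial_sum_hyperseq a D s ->
    D `<=` p.1 /\ forall x, D x -> s x = p.2 x.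

(* [get] picks a witness; [sigmaP] below shows that one exists when A is
   well-ordered.  It is unique up to irrelevant values outside its domain. *)
Definition sigma a : set (osucc A) * (osucc A -> Y) :=
  get (largest_partial_sum_hyperseq a).

Definition wo_series_cvg a : Prop := (sigma a).1 = setT.

Definition wo_series_sum a : Y := (sigma a).2 None.

End Hyperseries.

(* R^o is R seen as a normed space over itself. *)
Definition wo_series_abs_cvg {R : realType} {Y : normedModType R}
    {d : Order.disp_t} {A : orderType d} (a : A -> Y) : Prop :=
  wo_series_cvg ((fun i => `|a i|) : A -> R^o).

Section SigmaExists.
Context {R : realType} {Y : normedModType R} {d : Order.disp_t} {A : orderType d}.
Hypothesis wo : well_order (<=%O : rel A).

Lemma osucc_ind (P : osucc A -> Prop) :
  (forall x, (forall y, (y < x)%O -> P y) -> P x) -> forall x, P x.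
Proof.
move=> step.
have PS u : P (Some u).
  apply: contrapT => nPu.
  pose B : {pred A} := [pred v | `[< ~ P (Some v) >]].
  have BP v : v \in B <-> ~ P (Some v) by split=> /asboolP.
  have /wo[z [[zB zmin] _]] : nonempty B by exists u; apply/BP.
  move/BP: (zB); apply; apply: step => -[v|//] vz.
  apply: contrapT => /BP /zmin zv.
  by have : (v < z)%O := vz; rewrite ltNge zv.
by case=> // ; apply: step => -[v|].
Qed.

Lemma partial_sum_hyperseq_uniq (a : A -> Y) D s E t :
  partial_sum_hyperseq a D s -> partial_sum_hyperseq a E t ->
  forall x, D x -> E x -> s x = t x.
Proof.
move=> [[_ Dd] s0 sS sL] [[_ Ed] t0 tS tL]; elim/osucc_ind => x IH Dx Ex.
have {}IH y : (y < x)%O -> s y = t y.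
  by move=> yx; apply: IH => //; [apply: Dd Dx _|apply: Ed Ex _]; exact: ltW.
have [x0|nx0] := pselect (ord_zero x); first by rewrite s0 // t0.
have [[[u|] ux]|nS] := pselect (exists y, ord_next y x).
- by rewrite (sS _ _ ux Dx) (tS _ _ ux Ex) IH //; case: ux.
- by case: ux.
have lx : ord_limit x by [].
apply/eqP; rewrite -subr_eq0 -normr_eq0; apply/negPn/negP => st0.
have e0 : 0 < `|s x - t x| / 2 by rewrite divr_gt0 // lt_def st0 /=.
have [x1 x1x h1] := sL _ lx Dx _ e0; have [x2 x2x h2] := tL _ lx Ex _ e0.
pose z := Order.max x1 x2.
have zx : (z < x)%O by rewrite gt_max x1x.
have {h1} := h1 z; rewrite le_max lexx => /(_ isT zx) h1.
have {h2} := h2 z; rewrite le_max lexx orbT => /(_ isT zx) h2.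
have : `|s x - t x| < `|s x - t x|; last by rewrite ltxx.
rewrite {2}(splitr `|s x - t x|); apply: le_lt_trans (ltrD h1 h2).
rewrite (distrC (t x)) -(IH _ zx).
by apply: le_trans (ler_normD _ _); rewrite addrA subrK.
Qed.

Lemma sigmaP (a : A -> Y) : largest_partial_sum_hyperseq a (sigma a).
Proof.
apply: getPex.
pose D : set (osucc A) :=
  [set x | exists E t, partial_sum_hyperseq a E t /\ E x].
pose s x := get [set v | exists E t,
  [/\ partial_sum_hyperseq a E t, E x & t x = v]].
have sE E t x : partial_sum_hyperseq a E t -> E x -> s x = t x.
  move=> Et Ex; rewrite /s.
  case: (@getPex _ [set v | exists E t,
    [/\ partial_sum_hyperseq a E t, E x & t x = v]]).
    by exists (t x), E, t.
  by move=> E' [t' [Et' E'x <-]]; apply: partial_sum_hyperseq_uniq Et' Et _ _ _.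
have [z z0] : exists z : osucc A, ord_zero z.
  have [[u _]|nA] := pselect (exists u : A, True).
    have /wo[z [[_ zmin] _]] : nonempty (predT : {pred A}).
      by exists u.
    by exists (Some z) => -[v|] //; apply: zmin.
  by exists None => -[v|//]; case: nA; exists v.
have P0 : partial_sum_hyperseq a [set x | ord_zero x] (fun=> 0).
  split=> //.
  - by split; [exists z|move=> x y x0 yx w; apply: le_trans yx (x0 w)].
  - by move=> x y [xy _] /(_ (Some x)); rewrite leNgt xy.
  - by move=> l [].
exists (D, s); split=> /=; last first.
  by move=> E t Et; split=> [x Ex|x Ex]; [exists E, t|rewrite (sE _ _ _ Et Ex)].
split.
- split; first by exists z, [set x | ord_zero x], (fun=> 0).
  move=> x y [E [t [Et Ex]]] yx; exists E, t; split=> //.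
  by case: Et => -[_ Ed] _ _ _; apply: Ed Ex yx.
- by move=> x x0; rewrite (sE _ _ _ P0).
- move=> x y xy [E [t [Et Ey]]]; rewrite !(sE _ _ _ Et) //.
    by case: Et => _ _ tS _; apply: tS.
  by case: Et => -[_ Ed] _ _ _; apply: Ed Ey _; case: xy => /ltW.
- move=> l ll [E [t [Et El]]] e e0; case: (Et) => -[_ Ed] _ _ tL.
  have [x0 x0l h] := tL _ ll El _ e0; exists x0 => // x x0x xl.
  by rewrite !(sE _ _ _ Et) ?h //; apply: Ed El _; exact: ltW.
Qed.

End SigmaExists.

(* Main.v *)
(* The partial sum hypersequence at x is the ordinary sum of the subseries of
   those a_n whose position f^-1(n) lies below x.  At a successor this adds one
   term; at a limit l, all positions below l of the terms with n < N already lie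
   below some x0 < l, so from x0 on the sums differ from the one at l by at most
   the tail of the series of norms. *)
Require Import Defs.
From HB Require Import structures.
From mathcomp Require Import all_boot all_order all_algebra.
From mathcomp Require Import all_classical wochoice all_reals all_analysis.

Import Order.TTheory GRing.Theory Num.Theory.
Import numFieldNormedType.Exports.

Local Open Scope classical_set_scope.
Local Open Scope ring_scope.

(** The partial sums of the norms increase to their limit [L], so every tail from [N] on is at most
    [L] minus the [N]-th partial sum. *)
Lemma normed_series_tail (R : realType) (Y : normedModType R) (a : nat -> Y)
    (e : R) : cvgn [normed series a] -> 0 < e ->
  exists N, forall m, \sum_(N <= k < m) `|a k| <= e.
Proof.
move=> ca e0; set L := limn [normed series a].
have nd : nondecreasing_seq [normed series a].
  by apply: (@nondecreasing_series R (fun n => `|a n|) xpredT 0) => n _ _.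
have [N _ /(_ N (leqnn N)) /= hN] : \forall N \near \oo,
    `|L - [normed series a] N| < e.
  by move/cvgrPdist_lt: ca; apply.
exists N => m; have [mN|Nm] := leqP m N; first by rewrite big_geq // ltW.
have -> : \sum_(N <= k < m) `|a k| =
    [normed series a] m - [normed series a] N.
  by rewrite sub_series_geq // ltnW.
apply: le_trans (ltW hN); apply: le_trans (ler_norm _).
by rewrite lerB // nondecreasing_cvgn_le.
Qed.

Lemma cvgn_series_single (R : realType) (Y : normedModType R) (k : nat)
    (y : Y) : series (fun n => if n == k then y else 0) @ \oo --> y.
Proof.
apply: cvg_near_cst; exists k.+1 => // m /= km.
rewrite /series /= -big_mkcond /= big_nat1_eq.
by rewrite km.
Qed.

Section SubseriesBelow.
Context {R : realType} {Y : completeNormedModType R} (a : nat -> Y).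
Context {d : Order.disp_t} {A : orderType d} (f : A -> nat) (g : nat -> A).
Hypotheses (fK : cancel f g) (gK : cancel g f).
Hypothesis a_abs_cvg : cvgn [normed series a].

Local Notation pos n := (Some (g n) : osucc A).

(** Omitted terms become 0 instead of being reindexed, so the sums at different [x] can be compared
    index by index. *)
Definition terms_below (x : osucc A) (n : nat) : Y :=
  if (pos n < x)%O then a n else 0.

Lemma cvg_terms_below x : cvgn (series (terms_below x)).
Proof.
apply: normed_cvg; apply: (@series_le_cvg R _ (fun n => `|a n|)) => //= n.
by rewrite /terms_below; case: ifP => //; rewrite normr0.
Qed.

(** Finitely many positions below a limit have a bound below it: by induction on [N], take the
    maximum of the previous bound and a point strictly between [pos N] and [l]. *)
Lemma limit_above_initial_positions (l : osucc A) N : ord_limit l ->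
  exists2 x0 : osucc A, (x0 < l)%O &
    forall n, (n < N)%N -> (pos n < l)%O -> (pos n < x0)%O.
Proof.
move=> [nz nS]; elim: N => [|N [x0 x0l IH]].
  (* For [N = 0] any point below [l] serves; one exists because [l] is not zero. *)
  apply: contrapT => H; apply: nz => y; rewrite leNgt; apply/negP => yl.
  by apply: H; exists y.
have [gl|gl] := boolP (pos N < l)%O; last first.
  exists x0 => // n; rewrite ltnS leq_eqVlt => /orP[/eqP -> gl'|]; last exact: IH.
  by rewrite gl' in gl.
(* With nothing in between, [l] would be the successor of [pos N]. *)
have [z gz zl] : exists2 z, (pos N < z)%O & (z < l)%O.
  apply: contrapT => H; apply: nS; exists (pos N); split => // z gz.
  by rewrite leNgt; apply/negP => zl; apply: H; exists z.
exists (Order.max x0 z); first by rewrite gt_max x0l.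
move=> n; rewrite lt_max ltnS leq_eqVlt => /orP[/eqP ->|nN nl].
  by rewrite gz orbT.
by rewrite IH.
Qed.

Lemma partial_sum_hyperseq_terms_below :
  partial_sum_hyperseq (fun i => a (f i)) setT
    (fun x => limn (series (terms_below x))).
Proof.
split.
- by split; first by exists None.
- move=> x x0.
  have -> : terms_below x = fun=> 0.
    by apply/funext => n; rewrite /terms_below ltNge x0.
  apply/cvg_lim => //; apply: cvg_near_cst; apply: nearW => n.
  by rewrite /series /= big1.
- move=> x y [xy ymin] _.
  (* Passing from [x] to its successor changes only the entry at index [f x], the one whose position
     is [x] itself. *)
  have -> : terms_below y = terms_below (Some x) \+
      (fun n => if n == f x then a (f x) else 0).
    apply/funext => n; rewrite /terms_below /=.
    have [->|nx] := eqVneq n (f x); first by rewrite fK xy ltxx add0r.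
    have gx : g n != x by apply: contra nx => /eqP <-; rewrite gK.
    suff -> : (pos n < y)%O = (pos n < Some x)%O.
      by rewrite addr0.
    apply/idP/idP => [gy|/lt_trans]; last exact.
    rewrite lt_neqAle leNgt; apply/andP; split.
      by apply: contra gx => /eqP[->].
    by apply/negP => /ymin; rewrite leNgt gy.
  rewrite (_ : series _ = series (terms_below (Some x)) \+
      series (fun n => if n == f x then a (f x) else 0)); last first.
    by apply/funext => n; rewrite /series /= big_split.
  apply/cvg_lim => //; apply: cvgD; first exact: cvg_terms_below.
  exact: cvgn_series_single.
- move=> l ll _ e e0.
  have e2 : 0 < e / 2 by rewrite divr_gt0.
  have [N tailN] := normed_series_tail _ _ _ _ a_abs_cvg e2.
  have [x0 x0l hx0] := limit_above_initial_positions _ N ll.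
  exists x0 => // x x0x xl.
  (* Passing to the limit in [m] preserves only a non-strict bound, hence the tail bound [e / 2]. *)
  apply: (@le_lt_trans _ _ (e / 2)); last by rewrite gtr_pMr // invf_lt1 ?ltr1n.
  have cB : series (terms_below l) - series (terms_below x) @ \oo -->
      limn (series (terms_below l)) - limn (series (terms_below x)).
    by apply: cvgB; apply: cvg_terms_below.
  rewrite -(cvg_lim _ (cvg_norm cB)) //.
  apply: limr_le; first by apply/cvg_ex; eexists; exact: cvg_norm cB.
  apply: nearW => m; apply: le_trans (tailN m).
  rewrite /series /= !fctE -sumrB; apply: le_trans (ler_norm_sum _ _ _) _.
  (* For [k < N] the two entries agree: a position below [l] is already below [x0 <= x], and one not
     below [l] is not below [x]. *)
  have le_term k : `|terms_below l k - terms_below x k| <=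
      if (N <= k)%N then `|a k| else 0.
    rewrite /terms_below; have [kl|kl] := boolP (pos k < l)%O.
      have [kN|Nk] := ltnP k N.
        by rewrite (lt_le_trans (hx0 _ kN kl) x0x) subrr normr0.
      by case: ifP => _; rewrite ?subrr ?normr0 ?subr0.
    rewrite ifN; last by apply: contra kl => /lt_trans; apply.
    by rewrite subr0 normr0; case: ifP.
  apply: le_trans (ler_sum _ (fun k _ => le_term k)) _.
  rewrite -big_mkcond /=.
  by rewrite (big_nat_widenl N 0) //.
Qed.

End SubseriesBelow.

Lemma wo_series_rearrangement (R : realType) (Y : completeNormedModType R)
    (a : nat -> Y) (d : Order.disp_t) (A : orderType d) (f : A -> nat) :
  cvgn [normed series a] -> well_order (<=%O : rel A) -> bijective f ->
  wo_series_cvg (fun i => a (f i)) /\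
  wo_series_sum (fun i => a (f i)) = limn (series a).
Proof.
move=> ca wo [g fK gK].
(* Maximality of [sigma] forces its domain to be everything and its values to be the subseries
   sums. *)
have [_ /(_ _ _ (partial_sum_hyperseq_terms_below _ _ _ fK gK ca)) [sub eqs]] :=
  sigmaP wo (fun i => a (f i)).
split; first by apply/seteqP; split.
(* Every position lies below [None], so [terms_below a g None] computes to [a]. *)
by rewrite /wo_series_sum -eqs.
Qed.

Theorem theorem4p1 (R : realType) (X : completeNormedModType R) (a : nat -> X)
    (a_abs_cvg : cvgn [normed series a])
    (d : Order.disp_t) (alpha : orderType d)
    (alpha_wo : well_order (<=%O : rel alpha))
    (alpha_countable : countable [set: alpha])
    (alpha_infinite : infinite_set [set: alpha])
    (f : alpha -> nat) (f_bij : bijective f) :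
  wo_series_abs_cvg (fun i => a (f i)) /\
  wo_series_cvg (fun i => a (f i)) /\
  wo_series_sum (fun i => a (f i)) = limn (series a).
Proof.
split; last exact: wo_series_rearrangement.
(* Absolute convergence is the rearrangement result applied to the real series of norms, which is
   its own series of norms. *)
have norm_abs_cvg : cvgn [normed series (fun n => `|a n| : R^o)].
  rewrite (_ : [normed series _] = [normed series a]) //.
  by apply/funext => m; apply: eq_bigr => n _; exact: normr_id.
by have [] := wo_series_rearrangement _ _ _ _ _ _ norm_abs_cvg alpha_wo f_bij.
Qed.
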